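(* Let $\theta>0$ be a real number. Suppose that $|S_\theta(z_0,z_1,z_2)|\le 1$ for all $z_0\in\mathbb{C}$ and $z_1,z_2\in\mathbb{R}$ satisfying $$|z_0|\le 2\sqrt{\Re z_1\,\Re z_2},\qquad \Re z_1\le 0,\qquad \Re z_2\le 0.$$ Then $\theta\ge\frac{5}{12}$.
   Context: For a real parameter $\theta>0$ and $z_0,z_1,z_2\in\mathbb{C}$ with $\Re z_1\le 0$, $\Re z_2\le 0$, set $z=z_1+z_2$ and $p=(1-\theta z_1)(1-\theta z_2)$ (which is nonzero), and define $$S_\theta(z_0,z_1,z_2)=1+\frac{z_0+z}{p}+\theta\,\frac{z_0(z_0+z)}{p^2}+\left(\tfrac12-\theta\right)\frac{(z_0+z)^2}{p^2}.$$ This is the stability function of the Modified Craig--Sneyd (MCS) scheme with parameter $\theta$ applied to the scalar test equation $U'(t)=(\lambda_0+\lambda_1+\lambda_2)U(t)$ with $z_j=\Delta t\,\lambda_j$. *)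

(* Defs.v *)
From Stdlib Require Import Reals.
From Coquelicot Require Import Coquelicot.
Open Scope R_scope.

(* Stability function of the Modified Craig-Sneyd scheme.  Division in [C] is
   total; the denominator [p] is nonzero as soon as theta > 0, Re z1 <= 0 and
   Re z2 <= 0, so the junk value of [/ 0] plays no role on that domain. *)
Definition mcs_stab (theta : R) (z0 z1 z2 : C) : C :=
  (let z := z1 + z2 in
   let p := (1 - theta * z1) * (1 - theta * z2) in
   1 + (z0 + z) / p
   + theta * (z0 * (z0 + z) / p ^ 2)
   + (1 / 2 - theta) * ((z0 + z) ^ 2 / p ^ 2))%C.

(* Main.v *)
(** Take [z1 = z2 = -1/theta] and [z0 = (2/theta) e^(i phi)], on the boundary of
    the admissible disc.  With [c = e^(i phi) - 1] and [s = |c|^2], the stability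
    function is [1 + a c + b c^2] for [a = 3/(4 theta)], [b = 1/(8 theta^2)], and
    [|S|^2 = 1
       + s (4 theta^2 (5 - 12 theta) + s (8 theta^2 - 6 theta + 1)) / (64 theta^4)].
    If [theta < 5/12], then [|S| > 1] for small [s > 0]; the choice
    [s = (5 - 12 theta) / 2] turns the numerator into
    [s^2 (16 theta^2 - 6 theta + 1)], where the quadratic has negative
    discriminant. *)
Require Import Defs.
From Stdlib Require Import Reals Lra.
From Coquelicot Require Import Coquelicot.
Open Scope R_scope.

(** Both factors of [p] equal 2 and [z0 + z] is [2 * c / theta]; the two [c ^ 2 / (4 * theta)]
    contributions cancel. *)
Lemma mcs_stab_diag (theta : R) (c : C) : theta <> 0 ->
  mcs_stab theta (RtoC (2 / theta) * (1 + c))%C (RtoC (- / theta)) (RtoC (- / theta))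
  = (1 + RtoC (3 / (4 * theta)) * c + RtoC (1 / (8 * theta ^ 2)) * c ^ 2)%C.
Proof.
intros h0.
assert (hp : (1 - RtoC theta * RtoC (- / theta))%C = RtoC 2).
{ rewrite <- RtoC_mult, <- RtoC_minus. f_equal. field. exact h0. }
unfold mcs_stab. cbv zeta. rewrite hp.
destruct c as [x y].
unfold Cpow, Cdiv.
replace (RtoC 2 * RtoC 2)%C with (RtoC 4) by (rewrite <- RtoC_mult; f_equal; ring).
rewrite <- !RtoC_mult, <- !RtoC_inv by lra.
apply injective_projections; simpl; field; exact h0.
Qed.

Lemma Cmod_sqr (x y : R) : Cmod (x, y) ^ 2 = x ^ 2 + y ^ 2.
Proof. unfold Cmod; simpl fst; simpl snd. apply pow2_sqrt. nra. Qed.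

(** For [c = (- s / 2, d)] the hypothesis says [|c|^2 = s = -2 Re c], which puts [1 + c] on the unit
    circle. *)
Lemma Cmod_sqr_quadratic (a b s d : R) : d ^ 2 = s - s ^ 2 / 4 ->
  Cmod (1 + RtoC a * ((- s / 2)%R, d) + RtoC b * ((- s / 2)%R, d) ^ 2)%C ^ 2
  = 1 + s * (a ^ 2 - a - 2 * b + s * (b ^ 2 + b - a * b)).
Proof.
intros hd.
replace (1 + RtoC a * ((- s / 2)%R, d) + RtoC b * ((- s / 2)%R, d) ^ 2)%C
  with ((1 - a * s / 2 + b * (s ^ 2 / 4 - d ^ 2), d * (a - b * s)) : C).
2: apply injective_projections; simpl; field.
rewrite Cmod_sqr, Rpow_mult_distr, hd. field.
Qed.

Theorem theorem5 (theta : R) (htheta : 0 < theta)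
  (hS : forall (z0 : C) (z1 z2 : R),
      Cmod z0 <= 2 * sqrt (z1 * z2) -> z1 <= 0 -> z2 <= 0 ->
      Cmod (mcs_stab theta z0 (RtoC z1) (RtoC z2)) <= 1) :
  5 / 12 <= theta.
Proof.
apply Rnot_lt_le; intros hlt.
assert (hinv : 0 < / theta) by now apply Rinv_0_lt_compat.
set (s := (5 - 12 * theta) / 2).
assert (hs : 0 < s < 5 / 2) by (unfold s; lra).
set (d := sqrt (s - s ^ 2 / 4)).
(* The radicand is nonnegative because [0 < s < 4]. *)
assert (hd : d ^ 2 = s - s ^ 2 / 4) by (apply pow2_sqrt; nra).
assert (hunit : Cmod (1 + ((- s / 2)%R, d))%C = 1).
{ apply Rsqr_inj; [apply Cmod_ge_0 | lra |].
  rewrite !Rsqr_pow2. unfold Cplus; rewrite Cmod_sqr; simpl fst; simpl snd.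
  rewrite Rplus_0_l, hd. field. }
assert (hle := hS (RtoC (2 / theta) * (1 + ((- s / 2)%R, d)))%C (- / theta) (- / theta)).
rewrite mcs_stab_diag in hle by lra.
assert (hmod := Cmod_sqr_quadratic (3 / (4 * theta)) (1 / (8 * theta ^ 2)) s d hd).
set (S := (1 + _ + _)%C) in hle, hmod.
assert (hS1 : Cmod S <= 1).
{ apply hle; try lra.
  rewrite Cmod_mult, hunit, Cmod_R, Rabs_pos_eq by (apply Rlt_le, Rdiv_lt_0_compat; lra).
  replace (- / theta * - / theta) with (/ theta * / theta) by ring.
  rewrite sqrt_square by lra. apply Req_le. field. lra. }
assert (hS0 := Cmod_ge_0 S).
(* Since [5 - 12 * theta = 2 * s], a second factor [s] comes out. *)
match type of hmod with _ = 1 + ?e =>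
  replace e with (s ^ 2 * (16 * theta ^ 2 - 6 * theta + 1) / (64 * theta ^ 4)) in hmod
    by (unfold s; field; lra) end.
assert (hgt : 0 < s ^ 2 * (16 * theta ^ 2 - 6 * theta + 1) / (64 * theta ^ 4)).
{ assert (0 < theta ^ 4) by now apply pow_lt.
  assert (0 < s ^ 2) by now apply pow_lt.
  apply Rdiv_lt_0_compat; [apply Rmult_lt_0_compat |]; nra. }
nra.
Qed.
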